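(* Let $f:X\to Y$ be an onto, open and monotone mapping between continua, let $A\in 2^Y$ and let $n\in\mathbb N$. The following statements hold: (1) if $A\in NB_n(Y)$, then $f^{-1}(A)\in NB_n(X)$; (2) if $A\in NBO_n(Y)$, then $f^{-1}(A)\in NBO_n(X)$; (3) if $A\in NB_n^*(Y)$, then $f^{-1}(A)\in NB_n^*(X)$; (4) if $A\in S_n(Y)$, then $f^{-1}(A)\in S_n(X)$; (5) if $A\in NSC_n(Y)$, then $f^{-1}(A)\in NSC_n(X)$.
   Context: All spaces are metric; a mapping is a continuous function; a mapping $f:X\to Y$ is monotone if $f^{-1}(y)$ is connected for each $y\in Y$; a continuum is a compact connected space with more than one point; $\mathbb N=\{1,2,\dots\}$. For a non-empty space $Z$ and $n\in\mathbb N$: $2^Z$ is the set of non-empty compact subsets of $Z$; $F_n(Z)$ is the set of elements of $2^Z$ with at most $n$ points; $C_n(Z)$ is the set of elements of $2^Z$ with at most $n$ components. A non-empty space $Z$ is (interiors taken in $Z$): - $n$-$Q3$ if for every $x\in Z$ there exists $B\in F_n(Z)$ with $x\in B$ such that for every non-empty open set $U$ of $Z$ there exists a continuum $D\subset Z$ with $B\cap D\neq\emptyset\neq D\cap U$; - $n$-$Qo$ if there exists $B\in F_n(Z)$ such that for every non-empty open set $U$ of $Z$ there exists a continuum $D\subset Z$ with $B\cap \mathrm{int}(D)\neq\emptyset\neq \mathrm{int}(D)\cap U$; - $n$-$Q4$ if there exists $B\in F_n(Z)$ such that for every non-empty open set $U$ of $Z$ there exists a continuum $D\subset Z$ with $B\cap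 D\neq\emptyset\neq D\cap U$; - $n$-$Q5$ if for each finite family $\mathcal U$ of non-empty open subsets of $Z$ there exists $D\in C_n(Z)$ with $D\cap U\neq\emptyset$ for every $U\in\mathcal U$; - $n$-$Q6$ if for each collection of $n+1$ non-empty open sets $U_1,\dots,U_{n+1}$ of $Z$ there exists $D\in C_n(Z)$ with $D\cap U_i\neq\emptyset$ for every $i\in\{1,\dots,n+1\}$. For a non-degenerate compact metric space $Z$: $NB_n(Z)=\{A\in 2^Z: A=Z$ or $Z-A$ is $n$-$Q3\}$; $NBO_n(Z)=\{A\in 2^Z: A=Z$ or $Z-A$ is $n$-$Qo\}$; $NB_n^*(Z)=\{A\in 2^Z: A=Z$ or $Z-A$ is $n$-$Q4\}$; $S_n(Z)=\{A\in 2^Z: A=Z$ or $Z-A$ is $n$-$Q5\}$; $NSC_n(Z)=\{A\in 2^Z: A=Z$ or $Z-A$ is $n$-$Q6\}$. *)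

(* Defs.v *)
From HB Require Import structures.
From mathcomp Require Import all_boot all_order all_algebra.
From mathcomp Require Import all_classical all_reals all_analysis.

Set Implicit Arguments.
Unset Strict Implicit.
Unset Printing Implicit Defensive.

Local Open Scope classical_set_scope.
Local Open Scope card_scope.

(* Spaces are represented as subsets [Z] of an ambient space [T], with the
   topology induced by [T]. Compactness, connectedness and components of
   [D `<=` Z] depend only on [D] and are taken in [T]; openness and interiors
   relative to [Z] are those of the library type [subspace Z]. *)

Section Hyperspaces.
Context {T : topologicalType}.
Implicit Types (Z D B U : set T) (n : nat).

Definition continuum D :=
  [/\ compact D, connected D & exists x y, [/\ D x, D y & x <> y]].

Definition open_in Z U := U `<=` Z /\ open (U : set (subspace Z)).

Definition interior_in Z D : set T := interior (D : set (subspace Z)).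

Definition components D : set (set T) :=
  [set C | exists2 x, D x & C = connected_component D x].

(* 2^Z *)
Definition compacts Z : set (set T) :=
  [set D | [/\ D !=set0, compact D & D `<=` Z]].

(* F_n(Z) *)
Definition finite_hyperspace n Z : set (set T) :=
  [set B | compacts Z B /\ B #<= `I_n].

(* C_n(Z) *)
Definition component_hyperspace n Z : set (set T) :=
  [set D | compacts Z D /\ components D #<= `I_n].

Definition Q3 n Z :=
  Z !=set0 /\ forall x, Z x -> exists B, [/\ finite_hyperspace n Z B, B x &
    forall U, open_in Z U -> U !=set0 ->
      exists D, [/\ continuum D, D `<=` Z, B `&` D !=set0 & D `&` U !=set0]].

Definition Qo n Z :=
  Z !=set0 /\ exists B, finite_hyperspace n Z B /\
    forall U, open_in Z U -> U !=set0 ->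
      exists D, [/\ continuum D, D `<=` Z, B `&` interior_in Z D !=set0 &
                    interior_in Z D `&` U !=set0].

Definition Q4 n Z :=
  Z !=set0 /\ exists B, finite_hyperspace n Z B /\
    forall U, open_in Z U -> U !=set0 ->
      exists D, [/\ continuum D, D `<=` Z, B `&` D !=set0 & D `&` U !=set0].

Definition Q5 n Z :=
  Z !=set0 /\ forall F : set (set T), finite_set F ->
    (forall U, F U -> open_in Z U /\ U !=set0) ->
    exists2 D, component_hyperspace n Z D & forall U, F U -> D `&` U !=set0.

Definition Q6 n Z :=
  Z !=set0 /\ forall U : 'I_n.+1 -> set T,
    (forall i, open_in Z (U i) /\ U i !=set0) ->
    exists2 D, component_hyperspace n Z D & forall i, D `&` U i !=set0.

End Hyperspaces.

Definition NB n (T : topologicalType) : set (set T) :=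
  [set A | compacts [set: T] A /\ (A = [set: T] \/ Q3 n (~` A))].

Definition NBO n (T : topologicalType) : set (set T) :=
  [set A | compacts [set: T] A /\ (A = [set: T] \/ Qo n (~` A))].

(* NB_n^*(T) *)
Definition NBstar n (T : topologicalType) : set (set T) :=
  [set A | compacts [set: T] A /\ (A = [set: T] \/ Q4 n (~` A))].

(* S_n(T) *)
Definition Shyp n (T : topologicalType) : set (set T) :=
  [set A | compacts [set: T] A /\ (A = [set: T] \/ Q5 n (~` A))].

Definition NSC n (T : topologicalType) : set (set T) :=
  [set A | compacts [set: T] A /\ (A = [set: T] \/ Q6 n (~` A))].

Definition open_map (X Y : topologicalType) (f : X -> Y) :=
  forall U : set X, open U -> open (f @` U).

Definition monotone_map (X Y : topologicalType) (f : X -> Y) :=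
  forall y : Y, connected (f @^-1` [set y]).

Arguments NB : clear implicits.
Arguments NBO : clear implicits.
Arguments NBstar : clear implicits.
Arguments Shyp : clear implicits.
Arguments NSC : clear implicits.

(* Main.v *)
Require Import Defs.
From mathcomp Require Import all_boot all_order all_algebra.
From mathcomp Require Import all_classical all_reals all_analysis.

Set Implicit Arguments.
Unset Strict Implicit.
Unset Printing Implicit Defensive.

Local Open Scope classical_set_scope.
Local Open Scope card_scope.

(** The idea is that everything witnessing a property of [Y - A] can be pulled
    back along [f] to [X - f^-1(A)].

    The key fact is that an open monotone surjection pulls connected sets back
    to connected sets ([connected_preimage]).  By compactness of [X], preimages
    of continua are then continua ([continuum_preimage]), and the components of
    [f^-1(D)] are exactly the preimages of the components of [D], so that
    [f^-1] maps [C_n(Z)] into [C_n(f^-1(Z))]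
    ([component_hyperspace_preimage]).  The finite sets [B] in the definitions
    are instead lifted along a section of [f], which keeps the number of points
    and may be chosen through any prescribed point ([section_through]).

    To test the lifted witness against an open [U] of [X - f^-1(A)], use the
    original witness for [f(U)], which is open because [f] is: a set [D] meets
    [f(U)] exactly when [f^-1(D)] meets [U].  Since [Y - A] is open in [Y] and
    likewise upstairs, relative openness and relative interiors are the
    absolute ones. *)

(** * Relative topology of an open set *)

Lemma open_inE (T : topologicalType) (Z U : set T) :
  open Z -> open_in Z U <-> U `<=` Z /\ open U.
Proof.
move=> oZ; split=> -[UZ oU]; split=> //; last exact: open_subspaceW.
by move: oU; rewrite -open_setIS // ((setIidPl _ _).2 UZ).
Qed.

Lemma interior_inE (T : topologicalType) (Z D : set T) :
  open Z -> D `<=` Z -> interior_in Z D = interior D.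
Proof.
move=> oZ DZ.
have nbhsZ x : Z x -> nbhs (x : subspace Z) D = nbhs x D.
  by move=> Zx; rewrite -nbhs_subspace_interior // ((interior_id Z).1 oZ).
rewrite /interior_in /interior eqEsubset; split=> x /= Dx.
  by rewrite -nbhsZ //; apply: DZ; exact: nbhs_subspace_singleton Dx.
by rewrite nbhsZ //; apply: DZ; exact: nbhs_singleton Dx.
Qed.

(** * Sections of a surjection *)

(** Lifting a finite set along a section does not create points; the freedom to
    prescribe one value is what the property [Q3] requires. *)
Lemma section_through (X Y : Type) (f : X -> Y) (x : X) :
  range f = [set: Y] -> exists2 g : Y -> X, cancel g f & g (f x) = x.
Proof.
move=> f_onto.
have /choice[g gK] : forall y, exists z, f z = y /\ (y = f x -> z = x).
  move=> y.
  have [->|yfx] := pselect (y = f x); first by exists x.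
  have [z _ zy] : range f y by rewrite f_onto.
  by exists z.
by exists g => [y|]; [exact: (gK y).1|exact: (gK _).2].
Qed.

Lemma finite_hyperspace_lift (X Y : topologicalType) (f : X -> Y) (g : Y -> X)
    (n : nat) (Z B : set Y) :
  cancel g f -> finite_hyperspace n Z B ->
  finite_hyperspace n (f @^-1` Z) (g @` B).
Proof.
move=> gK [[[b Bb] _ BZ] Bn].
have gBn : g @` B #<= `I_n by exact: card_le_trans (card_image_le _ _) Bn.
split=> //; split.
- by exists (g b), b.
- by apply: finite_compact; apply/finite_set_leP; exists n.
- by move=> _ [y By <-]; rewrite /preimage /= gK; exact: BZ.
Qed.

Lemma lift_meets_preimage (X Y : Type) (f : X -> Y) (g : Y -> X)
    (B D : set Y) :
  cancel g f -> B `&` D !=set0 -> g @` B `&` f @^-1` D !=set0.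
Proof.
move=> gK [y [By Dy]]; exists (g y); split; first by exists y.
by rewrite /preimage /= gK.
Qed.

Lemma preimage_meets (X Y : Type) (f : X -> Y) (D : set Y) (U : set X) :
  D `&` f @` U !=set0 -> f @^-1` D `&` U !=set0.
Proof. by move=> [y [Dy [x Ux xy]]]; exists x; rewrite /preimage /= xy. Qed.

(** * Preimages of connected sets *)

(** A relatively clopen subset [B] of [f^-1(D)] contains every fibre that it
    meets, fibres being connected.  Hence [B] is the full preimage of [f(B)],
    and openness of [f] makes both [f(B)] and its complement in [D] relatively
    open: a nonempty [B] must then lie over all of [D]. *)
Lemma connected_preimage (X Y : topologicalType) (f : X -> Y) (D : set Y) :
  range f = [set: Y] -> open_map f -> monotone_map f ->
  connected D -> connected (f @^-1` D).
Proof.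
move=> f_onto f_open f_mono cD B [x0 Bx0] [G oG BG] [F cF BF].
have B_fibres x z : B x -> f z = f x -> B z.
  move=> Bx zx; suff fibreB : f @^-1` [set f x] `&` B = f @^-1` [set f x].
    have [] : (f @^-1` [set f x] `&` B) z by rewrite fibreB.
    by [].
  have [Dfx _] : (f @^-1` D `&` G) x by rewrite -BG.
  apply: (f_mono (f x)); first by exists x.
  - exists G => //; rewrite eqEsubset; split=> w [wx] //; last first.
      by move=> Gw; split=> //; rewrite BG; split=> //; rewrite /preimage /= wx.
    by rewrite BG => -[].
  - exists F => //; rewrite eqEsubset; split=> w [wx] //; last first.
      by move=> Fw; split=> //; rewrite BF; split=> //; rewrite /preimage /= wx.
    by rewrite BF => -[].
have fBD : f @` B = D.
  apply: cD; first by exists (f x0), x0.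
  - exists (f @` G); first exact: f_open.
    rewrite eqEsubset; split=> y.
      by move=> [x]; rewrite BG => -[Dx Gx] <-; split=> //; exists x.
    by move=> [Dy [x Gx xy]]; exists x; rewrite // BG /preimage /= xy.
  - exists (~` (f @` (~` F))).
      by apply: open_closedC; apply: f_open; exact: closed_openC.
    rewrite eqEsubset; split=> y.
      move=> [x Bx <-]; split; first by move: Bx; rewrite BG => -[].
      by move=> [z Fz zx]; apply: Fz; move: (B_fibres _ _ Bx zx); rewrite BF => -[].
    move=> [Dy yF]; have [x _ xy] : range f y by rewrite f_onto.
    exists x => //; rewrite BF; split; first by rewrite /preimage /= xy.
    by apply: contrapT => Fx; apply: yF; exists x.
rewrite eqEsubset; split=> x; first by rewrite BG => -[].
by rewrite /preimage /= -fBD => -[z Bz zx]; exact: B_fibres Bz _.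
Qed.

Lemma connected_component_preimage (X Y : topologicalType) (f : X -> Y)
    (D : set Y) (x : X) :
  continuous f -> range f = [set: Y] -> open_map f -> monotone_map f ->
  D (f x) ->
  connected_component (f @^-1` D) x = f @^-1` (connected_component D (f x)).
Proof.
move=> f_cont f_onto f_open f_mono Dfx; rewrite eqEsubset; split.
  apply: subset_trans (@preimage_image _ _ f _) _; apply: preimage_subset.
  apply: connected_component_max.
  - by exists x; first exact: connected_component_refl.
  - by move=> _ [z /connected_component_sub Dz <-].
  - apply: connected_continuous_connected; first exact: component_connected.
    exact: continuous_subspaceT.
apply: connected_component_max.
- exact: connected_component_refl.
- by apply: preimage_subset; exact: connected_component_sub.
- by apply: connected_preimage => //; exact: component_connected.
Qed.

(** * Pulling back continua and hyperspaces *)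

Lemma compact_preimage (X Y : topologicalType) (f : X -> Y) (D : set Y) :
  compact [set: X] -> hausdorff_space Y -> continuous f ->
  compact D -> compact (f @^-1` D).
Proof.
move=> cX hY f_cont cD; apply: subclosed_compact cX _ => //.
by move/continuous_closedP: f_cont; apply; exact: compact_closed.
Qed.

Lemma compacts_preimage (X Y : topologicalType) (f : X -> Y) (Z D : set Y) :
  compact [set: X] -> hausdorff_space Y -> continuous f ->
  range f = [set: Y] -> compacts Z D -> compacts (f @^-1` Z) (f @^-1` D).
Proof.
move=> cX hY f_cont f_onto [[y Dy] cD DZ]; split.
- have [x _ xy] : range f y by rewrite f_onto.
  by exists x; rewrite /preimage /= xy.
- exact: compact_preimage.
- exact: preimage_subset.
Qed.

Lemma continuum_preimage (X Y : topologicalType) (f : X -> Y) (D : set Y) :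
  compact [set: X] -> hausdorff_space Y -> continuous f ->
  range f = [set: Y] -> open_map f -> monotone_map f ->
  continuum D -> continuum (f @^-1` D).
Proof.
move=> cX hY f_cont f_onto f_open f_mono [cD kD [a [b [Da Db ab]]]]; split.
- exact: compact_preimage.
- exact: connected_preimage.
- have [x _ xa] : range f a by rewrite f_onto.
  have [z _ zb] : range f b by rewrite f_onto.
  exists x, z; rewrite /preimage /= xa zb; split=> // xz.
  by apply: ab; rewrite -xa -zb xz.
Qed.

Lemma component_hyperspace_preimage (X Y : topologicalType) (f : X -> Y)
    (n : nat) (Z D : set Y) :
  compact [set: X] -> hausdorff_space Y -> continuous f ->
  range f = [set: Y] -> open_map f -> monotone_map f ->
  component_hyperspace n Z D ->
  component_hyperspace n (f @^-1` Z) (f @^-1` D).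
Proof.
move=> cX hY f_cont f_onto f_open f_mono [DZ Dn].
split; first exact: compacts_preimage.
apply: card_le_trans Dn.
apply: card_le_trans (card_image_le (preimage f) (components D)).
apply: subset_card_le => _ [x Dx ->].
exists (connected_component D (f x)); first by exists (f x).
by rewrite connected_component_preimage.
Qed.

Lemma open_in_image (X Y : topologicalType) (f : X -> Y) (Z : set Y)
    (U : set X) :
  continuous f -> open_map f -> open Z ->
  open_in (f @^-1` Z) U -> open_in Z (f @` U).
Proof.
move=> f_cont f_open oZ.
have oZ' : open (f @^-1` Z) by apply: open_comp => // x _; exact: f_cont.
move=> /(open_inE _ oZ')[UZ oU]; apply/open_inE => //.
by split; [move=> _ [x /UZ Zx <-]|exact: f_open].
Qed.

Lemma nonempty_preimage (X Y : Type) (f : X -> Y) (Z : set Y) :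
  range f = [set: Y] -> Z !=set0 -> f @^-1` Z !=set0.
Proof.
move=> f_onto [y Zy]; have [x _ xy] : range f y by rewrite f_onto.
by exists x; rewrite /preimage /= xy.
Qed.

(** * Pulling back the properties of open sets *)

Section PullBack.
Context {X Y : topologicalType} (f : X -> Y) (n : nat) (Z : set Y).

Lemma Q3_preimage :
  compact [set: X] -> hausdorff_space Y -> continuous f ->
  range f = [set: Y] -> open_map f -> monotone_map f -> open Z ->
  Q3 n Z -> Q3 n (f @^-1` Z).
Proof.
move=> cX hY f_cont f_onto f_open f_mono oZ [Z0 ZQ].
split=> [|x Zx]; first exact: nonempty_preimage.
have [B [Bn Bfx BQ]] := ZQ _ Zx.
have [g gK gx] := section_through x f_onto.
exists (g @` B); split; [exact: finite_hyperspace_lift|by exists (f x)|].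
move=> U /(open_in_image f_cont f_open oZ) oU [u Uu].
have [|D [cD DZ BD DU]] := BQ _ oU; first by exists (f u), u.
exists (f @^-1` D); split.
- exact: continuum_preimage.
- exact: preimage_subset.
- exact: lift_meets_preimage.
- exact: preimage_meets.
Qed.

Lemma Qo_preimage :
  compact [set: X] -> hausdorff_space Y -> continuous f ->
  range f = [set: Y] -> open_map f -> monotone_map f -> open Z ->
  Qo n Z -> Qo n (f @^-1` Z).
Proof.
move=> cX hY f_cont f_onto f_open f_mono oZ [Z0 [B [Bn BQ]]].
have [x Zx] := nonempty_preimage f_onto Z0.
split; first by exists x.
have [g gK _] := section_through x f_onto.
exists (g @` B); split; first exact: finite_hyperspace_lift.
move=> U /(open_in_image f_cont f_open oZ) oU [u Uu].
have [|D [cD DZ BD DU]] := BQ _ oU; first by exists (f u), u.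
have oZ' : open (f @^-1` Z) by apply: open_comp => // z _; exact: f_cont.
(* Relative interiors are absolute here, and then this is just continuity. *)
have intD : f @^-1` interior_in Z D `<=` interior_in (f @^-1` Z) (f @^-1` D).
  rewrite !interior_inE //; last exact: preimage_subset.
  by move=> z; exact: f_cont.
exists (f @^-1` D); split.
- exact: continuum_preimage.
- exact: preimage_subset.
- apply: subset_nonempty (lift_meets_preimage gK BD).
  exact: setIS.
- apply: subset_nonempty (preimage_meets DU).
  exact: setSI.
Qed.

Lemma Q4_preimage :
  compact [set: X] -> hausdorff_space Y -> continuous f ->
  range f = [set: Y] -> open_map f -> monotone_map f -> open Z ->
  Q4 n Z -> Q4 n (f @^-1` Z).
Proof.
move=> cX hY f_cont f_onto f_open f_mono oZ [Z0 [B [Bn BQ]]].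
have [x Zx] := nonempty_preimage f_onto Z0.
split; first by exists x.
have [g gK _] := section_through x f_onto.
exists (g @` B); split; first exact: finite_hyperspace_lift.
move=> U /(open_in_image f_cont f_open oZ) oU [u Uu].
have [|D [cD DZ BD DU]] := BQ _ oU; first by exists (f u), u.
exists (f @^-1` D); split.
- exact: continuum_preimage.
- exact: preimage_subset.
- exact: lift_meets_preimage.
- exact: preimage_meets.
Qed.

Lemma Q5_preimage :
  compact [set: X] -> hausdorff_space Y -> continuous f ->
  range f = [set: Y] -> open_map f -> monotone_map f -> open Z ->
  Q5 n Z -> Q5 n (f @^-1` Z).
Proof.
move=> cX hY f_cont f_onto f_open f_mono oZ [Z0 ZQ].
split=> [|F finF FU]; first exact: nonempty_preimage.
have [||D Dn DF] := ZQ [set f @` U | U in F].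
- exact: finite_image.
- move=> _ [U /FU[oU [u Uu]] <-]; split; last by exists (f u), u.
  exact: open_in_image.
exists (f @^-1` D); first exact: component_hyperspace_preimage.
by move=> U FU'; apply: preimage_meets; apply: DF; exists U.
Qed.

Lemma Q6_preimage :
  compact [set: X] -> hausdorff_space Y -> continuous f ->
  range f = [set: Y] -> open_map f -> monotone_map f -> open Z ->
  Q6 n Z -> Q6 n (f @^-1` Z).
Proof.
move=> cX hY f_cont f_onto f_open f_mono oZ [Z0 ZQ].
split=> [|U UZ]; first exact: nonempty_preimage.
have [|D Dn DU] := ZQ (fun i => f @` U i).
  move=> i; have [oU [u Uu]] := UZ i; split; last by exists (f u), u.
  exact: open_in_image.
exists (f @^-1` D); first exact: component_hyperspace_preimage.
by move=> i; exact: preimage_meets.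
Qed.

End PullBack.

Theorem proposition4p7 (R : realType) (X Y : metricType R) (f : X -> Y)
    (A : set Y) (n : nat) :
  continuum [set: X] -> continuum [set: Y] ->
  continuous f -> range f = [set: Y] -> open_map f -> monotone_map f ->
  compacts [set: Y] A -> (0 < n)%N ->
  (NB n Y A -> NB n X (f @^-1` A)) /\
  (NBO n Y A -> NBO n X (f @^-1` A)) /\
  (NBstar n Y A -> NBstar n X (f @^-1` A)) /\
  (Shyp n Y A -> Shyp n X (f @^-1` A)) /\
  (NSC n Y A -> NSC n X (f @^-1` A)).
Proof.
move=> [cX _ _] _ f_cont f_onto f_open f_mono cA _.
have hY : hausdorff_space Y by exact: metric_hausdorff.
have oA : open (~` A).
  by apply: closed_openC; apply: compact_closed => //; case: cA.
have cfA : compacts [set: X] (f @^-1` A).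
  by rewrite -(preimage_setT f); exact: compacts_preimage.
have transfer (P : set Y -> Prop) (Q : set X -> Prop) :
    (P (~` A) -> Q (f @^-1` ~` A)) -> A = [set: Y] \/ P (~` A) ->
    f @^-1` A = [set: X] \/ Q (~` (f @^-1` A)).
  by move=> PQ [->|/PQ]; [left; exact: preimage_setT|right].
split; first by move=> [_ H]; split=> //; apply: transfer H; exact: Q3_preimage.
split; first by move=> [_ H]; split=> //; apply: transfer H; exact: Qo_preimage.
split; first by move=> [_ H]; split=> //; apply: transfer H; exact: Q4_preimage.
split; first by move=> [_ H]; split=> //; apply: transfer H; exact: Q5_preimage.
by move=> [_ H]; split=> //; apply: transfer H; exact: Q6_preimage.
Qed.
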